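(* Denote by $\Omega$ the set of second-order stationary points of $f:\mathbb{R}^d\to\mathbb{R}$. Let Assumption A hold and assume that $f$ satisfies the KŁ property, with parameter $\theta\in(0,1]$ (both defined in the context). Then there exist $\kappa,\varepsilon,\lambda>0$ such that for all $\mathbf{x}\in\{\mathbf{z}\in\mathbb{R}^d:\ \mathrm{dist}_\Omega(\mathbf{z})<\varepsilon,\ f_\Omega<f(\mathbf{z})<f_\Omega+\lambda\}$, the following property (KŁ-error bound) holds: $$\mathrm{dist}_\Omega(\mathbf{x})\le\kappa\,\|\nabla f(\mathbf{x})\|^{\frac{\theta}{1-\theta}}.$$
   Context: Norms are Euclidean for vectors and operator norms for matrices; for a set $S$, $\mathrm{dist}_S(\mathbf{x}):=\inf_{\mathbf{w}\in S}\|\mathbf{x}-\mathbf{w}\|$. A second-order stationary point of $f$ is a point $\bar{\mathbf{x}}$ with $\nabla f(\bar{\mathbf{x}})=\mathbf{0}$ and $\nabla^2 f(\bar{\mathbf{x}})\succeq\mathbf{0}$. Assumption A: (i) $f$ is continuously twice-differentiable and bounded below, i.e. $\inf_{\mathbf{x}\in\mathbb{R}^d} f(\mathbf{x})>-\infty$; (ii) for any $\alpha\in\mathbb{R}$, the sub-level set $\{\mathbf{x}: f(\mathbf{x})\le\alpha\}$ is compact; (iii) the Hessian of $f$ is $L$-Lipschitz continuous on a compact set $\mathcal{C}$, i.e. $\|\nabla^2 f(\mathbf{x})-\nabla^2 f(\mathbf{y})\|\le L\|\mathbf{x}-\mathbf{y}\|$ for $\mathbf{x},\mathbf{y}\in\mathcal{C}$.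 KŁ property: a proper and lower-semicontinuous function $f$ satisfies the KŁ property if for every compact set $S\subset\mathrm{dom} f$ on which $f$ takes a constant value $f_S\in\mathbb{R}$, there exist $\varepsilon,\lambda>0$ such that for all $\bar{\mathbf{x}}\in S$ and all $\mathbf{x}\in\{\mathbf{z}\in\mathbb{R}^d:\mathrm{dist}_S(\mathbf{z})<\varepsilon,\ f_S<f(\mathbf{z})<f_S+\lambda\}$ one has $\varphi'(f(\mathbf{x})-f_S)\cdot\mathrm{dist}_{\partial f(\mathbf{x})}(\mathbf{0})\ge1$, where $\varphi:[0,\lambda)\to\mathbb{R}_+$ takes the form $\varphi(t)=\frac{c}{\theta}t^\theta$ for some constants $c>0$, $\theta\in(0,1]$. Here $\partial f$ is the (limiting) subdifferential; for the differentiable $f$ considered here $\partial f=\nabla f$, so $\mathrm{dist}_{\partial f(\mathbf{x})}(\mathbf{0})=\|\nabla f(\mathbf{x})\|$. The symbol $f_\Omega$ in the claim is the notation of this definition with $S=\Omega$, i.e. the value of $f$ on $\Omega$. *)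

(* Defs.v *)
(* MathComp-Analysis *)
From HB Require Import structures.
From mathcomp Require Import all_boot all_order all_algebra.
From mathcomp Require Import all_classical all_reals all_analysis.

Set Implicit Arguments.
Unset Strict Implicit.
Unset Printing Implicit Defensive.

Import Order.TTheory GRing.Theory Num.Theory.
Import numFieldNormedType.Exports.
Local Open Scope classical_set_scope.
Local Open Scope ring_scope.

(* The canonical norm of 'rV[R]_d is the sup norm, hence the following two
   definitions; the topologies coincide. *)
Definition enorm (R : realType) (d : nat) (x : 'rV[R]_d) : R :=
  Num.sqrt (\sum_(i < d) x ord0 i ^+ 2).

Definition opnorm (R : realType) (d : nat) (A : 'M[R]_d) : R :=
  sup [set enorm (v *m A) | v in [set v : 'rV[R]_d | enorm v <= 1]].

(* Extended-real valued, so that the distance to the empty set is +oo. *)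
Definition dist_set (R : realType) (d : nat) (S : set 'rV[R]_d)
    (x : 'rV[R]_d) : \bar R :=
  ereal_inf [set (enorm (x - w))%:E | w in S].

Definition grad (R : realType) (d : nat) (f : 'rV[R]_d -> R)
    (x : 'rV[R]_d) : 'rV[R]_d :=
  \row_(i < d) 'D_(delta_mx ord0 i) f x.

Definition hessian (R : realType) (d : nat) (f : 'rV[R]_d -> R)
    (x : 'rV[R]_d) : 'M[R]_d :=
  'J (grad f) x.

Definition psd (R : realType) (d : nat) (A : 'M[R]_d) : Prop :=
  forall v : 'rV[R]_d, 0 <= (v *m A *m v^T) ord0 ord0.

Definition continuously_twice_differentiable (R : realType) (d : nat)
    (f : 'rV[R]_d -> R) : Prop :=
  [/\ forall x, differentiable f x,
      forall x, differentiable (grad f) x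
    & continuous (hessian f)].

Definition second_order_stationary (R : realType) (d : nat)
    (f : 'rV[R]_d -> R) : set 'rV[R]_d :=
  [set x | grad f x = 0 /\ psd (hessian f x)].

Definition assumptionA (R : realType) (d : nat) (f : 'rV[R]_d -> R)
    (L : R) (C : set 'rV[R]_d) : Prop :=
  [/\ continuously_twice_differentiable f,
      has_lbound (range f),
      forall alpha : R, compact [set x | f x <= alpha],
      compact C
    & forall x y, C x -> C y ->
        opnorm (hessian f x - hessian f y) <= L * enorm (x - y)].

Definition takes_constant_value (R : realType) (d : nat)
    (f : 'rV[R]_d -> R) (S : set 'rV[R]_d) (fS : R) : Prop :=
  forall x, S x -> f x = fS.

Definition desingularizing (R : realType) (c theta t : R) : R :=
  c / theta * t `^ theta.

Definition level_neighborhood (R : realType) (d : nat)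
    (f : 'rV[R]_d -> R) (S : set 'rV[R]_d) (fS epsilon lambda : R) :
    set 'rV[R]_d :=
  [set z | (dist_set S z < epsilon%:E)%E /\ fS < f z < fS + lambda].

(* Kurdyka-Lojasiewicz property with exponent parameter theta, for a
   differentiable real-valued f: the subdifferential of f at x is the
   singleton of its gradient, so the distance from 0 to it is
   enorm (grad f x), and dom f is the whole space.  The exponent theta is
   common to all S; c, epsilon and lambda may depend on S. *)
Definition KL_property (R : realType) (d : nat) (f : 'rV[R]_d -> R)
    (theta : R) : Prop :=
  0 < theta <= 1 /\
  forall (S : set 'rV[R]_d) (fS : R),
    compact S -> takes_constant_value f S fS ->
    exists epsilon lambda c : R,
      [/\ 0 < epsilon, 0 < lambda, 0 < c
        & forall xbar x, S xbar ->
            level_neighborhood f S fS epsilon lambda x ->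
            1 <= derive1 (desingularizing c theta) (f x - fS)
                 * enorm (grad f x)].

(* At e = +oo and e = -oo the value is the limit, for t > 0, of t `^ r as the
   real exponent r tends to e, and it is extended to t = 0 by continuity.
   Since 0^-1 = +oo in \bar R, the exponent theta%:E / (1 - theta)%:E is
   +oo for theta = 1. *)
Definition epowR (R : realType) (t : R) (e : \bar R) : \bar R :=
  match e with
  | r%:E => (t `^ r)%:E
  | +oo => if (t < 1)%R then 0%:E else if (t == 1)%R then 1%:E else +oo
  | -oo => if (t < 1)%R then +oo else if (t == 1)%R then 1%:E else 0%:E
  end%E.

(* Main.v *)
Require Import Defs.
From mathcomp Require Import all_boot all_order all_algebra.
From mathcomp Require Import all_classical all_reals all_analysis.
From mathcomp Require Import ring lra.

Set Implicit Arguments.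
Unset Strict Implicit.
Unset Printing Implicit Defensive.

Import Order.TTheory GRing.Theory Num.Theory.
Import numFieldNormedType.Exports.
Local Open Scope classical_set_scope.
Local Open Scope ring_scope.

(** Since [f] has compact sublevel sets it has a global minimizer, which is a
    second-order stationary point.  As [f] takes the single value [fOmega] on
    Omega, that value is the minimum of [f], and conversely every point where
    [f] equals it is a global minimizer; so Omega is the sublevel set
    [f <= fOmega] ([second_order_stationary_argmin]), which is compact, and the
    KL property applies to it.  Write [m] for [fOmega] and [phi] for the
    desingularizing function.

    The KL inequality says that, close to Omega, [phi \o (f - m)] has slope at
    least 1 wherever [f > m].  Such a function bounds the distance to its zero
    set: minimize [phi (f y - m) + |y - x| / 2] over [y].  A minimizer [z] with
    [f z > m] would be a point where the slope of [phi \o (f - m)] is at most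
    1/2 ([penalized_min_slope_le]); hence [f z = m], and comparing the values at
    [z] and at [x] gives [|x - z| <= 2 * phi (f x - m)] ([dist_argmin_le]).  This
    replaces the usual length estimate for a descent trajectory by one
    application of the extreme value theorem.

    It remains to bound [phi (f x - m)] by the gradient.  For [theta < 1] the KL
    inequality reads [(f x - m) `^ (1 - theta) <= c * |grad f x|], and raising
    it to the power [theta / (1 - theta)] gives the claim ([gap_powR_le]).  For
    [theta = 1] it reads [1 <= c * |grad f x|], which fails at all points of
    small enough value, since the gradient tends to 0 as [f] tends to [m]
    ([gradient_small_near_min]); there the neighbourhood in the claim is
    empty. *)

(** * The Euclidean norm *)

Definition dot (R : realType) (d : nat) (u v : 'rV[R]_d) : R :=
  \sum_(i < d) u ord0 i * v ord0 i.

Section EuclideanNorm.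
Variables (R : realType) (d : nat).
Implicit Types u v w : 'rV[R]_d.

Lemma dotC u v : dot u v = dot v u.
Proof. by apply: eq_bigr => i _; rewrite mulrC. Qed.

Lemma dotDl u v w : dot (u + v) w = dot u w + dot v w.
Proof.
by rewrite /dot -big_split; apply: eq_bigr => i _; rewrite mxE mulrDl.
Qed.

Lemma dotZl (a : R) u v : dot (a *: u) v = a * dot u v.
Proof.
by rewrite /dot mulr_sumr; apply: eq_bigr => i _; rewrite mxE mulrA.
Qed.

Lemma dotNl u v : dot (- u) v = - dot u v.
Proof. by rewrite -scaleN1r dotZl mulN1r. Qed.

Lemma dot_mulmx u v : (u *m v^T) ord0 ord0 = dot u v.
Proof. by rewrite mxE; apply: eq_bigr => i _; rewrite mxE. Qed.

Lemma dot_ge0 u : 0 <= dot u u.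
Proof. by apply: sumr_ge0 => i _; rewrite -expr2 sqr_ge0. Qed.

Lemma enormE u : enorm u = Num.sqrt (dot u u).
Proof. by congr Num.sqrt; apply: eq_bigr => i _; rewrite expr2. Qed.

Lemma enorm_ge0 u : 0 <= enorm u. Proof. exact: sqrtr_ge0. Qed.

Lemma sqr_enorm u : enorm u ^+ 2 = dot u u.
Proof. by rewrite enormE sqr_sqrtr // dot_ge0. Qed.

Lemma enorm0 : enorm (0 : 'rV[R]_d) = 0.
Proof. by rewrite enormE -(scale0r 0) dotZl mul0r sqrtr0. Qed.

Lemma enorm_eq0 u : enorm u = 0 -> u = 0.
Proof.
move=> u0; have := sqr_enorm u; rewrite u0 expr0n /= => /esym/eqP.
rewrite psumr_eq0 => [/allP sq0|i _]; last by rewrite -expr2 sqr_ge0.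
apply/rowP => i; rewrite mxE; apply/eqP.
by have := sq0 i (mem_index_enum i); rewrite /= mulf_eq0 orbb.
Qed.

Lemma enormZ (a : R) u : enorm (a *: u) = `|a| * enorm u.
Proof.
rewrite !enormE dotZl dotC dotZl mulrA -expr2 sqrtrM ?sqr_ge0//.
by rewrite sqrtr_sqr.
Qed.

Lemma enormN u : enorm (- u) = enorm u.
Proof. by rewrite -scaleN1r enormZ normrN1 mul1r. Qed.

(** The Cauchy-Schwarz inequality, by Lagrange's identity: the sum of the
    squares of all the 2 x 2 minors of the rows [u] and [v] is twice the deficit
    in the inequality. *)
Lemma sqr_dot_le u v : dot u v ^+ 2 <= dot u u * dot v v.
Proof.
have : 0 <= \sum_(i < d) dot (u ord0 i *: v - v ord0 i *: u)
                             (u ord0 i *: v - v ord0 i *: u).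
  by apply: sumr_ge0 => i _; exact: dot_ge0.
have minors (a b : R) : dot (a *: v - b *: u) (a *: v - b *: u) =
    a * a * dot v v - 2 * dot u v * (a * b) + b * b * dot u u.
  rewrite dotDl dotNl !dotZl ![dot _ (_ - _)]dotC !dotDl !dotNl !dotZl.
  by rewrite (dotC v u); ring.
under eq_bigr do rewrite minors.
rewrite !big_split/= sumrN -!mulr_suml -mulr_sumr -!/(dot _ _).
by rewrite -subr_ge0 => deficit; nra.
Qed.

Lemma dot_le_enorm u v : dot u v <= enorm u * enorm v.
Proof.
rewrite !enormE -sqrtrM ?dot_ge0// (le_trans (ler_norm _))//.
by rewrite -sqrtr_sqr ler_wsqrtr// sqr_dot_le.
Qed.

Lemma enormD u v : enorm (u + v) <= enorm u + enorm v.
Proof.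
rewrite -ler_sqr ?nnegrE ?addr_ge0 ?enorm_ge0//.
rewrite sqr_enorm dotDl ![dot _ (_ + _)]dotC !dotDl (dotC v u) -!sqr_enorm.
by have := dot_le_enorm u v; nra.
Qed.

Lemma dist_triangle u v w : enorm (u - w) <= enorm (u - v) + enorm (v - w).
Proof. by rewrite -[u - w](subrKA v) enormD. Qed.

Lemma continuous_dotl v : continuous (fun u => dot u v).
Proof.
apply: continuous_big => [|i _]; first exact: add_continuous.
move=> u; apply: continuousM; first exact: coord_continuous.
exact: cst_continuous.
Qed.

Lemma continuous_enorm : continuous (@enorm R d).
Proof.
rewrite (_ : @enorm R d = Num.sqrt \o (fun u => dot u u)); last first.
  by apply/funext => u; exact: enormE.
move=> u; apply: continuous_comp; last exact: sqrt_continuous.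
move: u; apply: continuous_big => [|i _ u]; first exact: add_continuous.
by apply: continuousM; exact: coord_continuous.
Qed.

End EuclideanNorm.

(** * Derivatives along lines *)

Section OneVariable.
Variable R : realType.
Implicit Types (u g k : R -> R) (a b : R).

Lemma is_derive_lt_affine u a b : is_derive (0 : R) 1 u a -> a < b ->
  exists2 e, 0 < e & forall t, 0 < t < e -> u t < u 0 + b * t.
Proof.
move=> [du <-] ab.
have := @cvgr_lt _ _ _ _ _ _ du _ ab.
rewrite near_withinE => /(_ (dnbhs_filter _)) /nbhs_ballP[e /= e0 ball_e].
exists e => // t /andP[t0 te].
have : ball 0 e t by rewrite -ball_normE /= sub0r normrN gtr0_norm.
move=> /ball_e /(_ (lt0r_neq0 t0)).
rewrite /GRing.scale /= mulr1 addr0 -(ltr_pM2l t0) mulrA divff ?gt_eqF//.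
by rewrite mul1r ltrBlDl (mulrC t).
Qed.

Lemma slope_ge u a b : is_derive (0 : R) 1 u a ->
  (forall t, 0 < t -> u 0 <= u t + b * t) -> - b <= a.
Proof.
move=> ua u0; rewrite leNgt; apply/negP => /(is_derive_lt_affine ua)[e e0 ue].
have e2 : 0 < e / 2 by rewrite divr_gt0.
have := ue (e / 2); rewrite e2/= ltr_pdivrMr// ltr_pMr// ltr1n => /(_ isT).
by have := u0 _ e2; lra.
Qed.

(** If the second derivative a were negative, the derivative k, which starts
    at 0, would be negative just after 0, and the mean value theorem would put
    a smaller value of g there. *)
Lemma second_derivative_min_ge0 g k a :
  (forall t : R, is_derive t 1 g (k t)) -> k 0 = 0 -> is_derive (0 : R) 1 k a ->
  (forall t, g 0 <= g t) -> 0 <= a.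
Proof.
move=> gk k0 ka gmin; rewrite leNgt; apply/negP.
move=> /(is_derive_lt_affine ka)[e e0 ke].
have e2 : 0 < e / 2 by rewrite divr_gt0.
have cont_g : {within `[0, e / 2], continuous g}.
  apply: continuous_subspaceT => t.
  by apply/differentiable_continuous/derivable1_diffP; have [] := gk t.
have [c] := MVT e2 (fun t _ => gk t) cont_g.
rewrite in_itv /= => /andP[c0 ce].
have := ke c; rewrite c0 k0 (lt_trans ce) /=; last first.
  by rewrite ltr_pdivrMr// ltr_pMr// ltr1n.
by move=> /(_ isT) kc; have := gmin (e / 2); nra.
Qed.

End OneVariable.

Section Lines.
Variables (R : realType) (d : nat).
Implicit Types (f : 'rV[R]_d -> R) (x v : 'rV[R]_d).

(** Both derivatives are limits of the same difference quotient. *)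
Lemma is_derive_line (W : normedModType R) (F : 'rV[R]_d -> W) x v (t : R) :
  differentiable F (x + t *: v) ->
  is_derive t 1 (fun s : R => F (x + s *: v)) ('D_v F (x + t *: v)).
Proof.
move=> dF; have quotients :
    (fun h : R => h^-1 *: (((fun s : R => F (x + s *: v)) \o shift t) (h *: 1)
                     - F (x + t *: v))) =
    (fun h => h^-1 *: ((F \o shift (x + t *: v)) (h *: v) - F (x + t *: v))).
  apply/funext => h /=; congr (_ *: (F _ - _)).
  by rewrite [h%:A]mulr1 scalerDl addrCA.
split; last by rewrite /derive quotients.
by rewrite /derivable quotients; exact: diff_derivable.
Qed.

Lemma derive_grad f x v : differentiable f x -> 'D_v f x = dot (grad f x) v.
Proof.
move=> df; rewrite deriveE// {1}(row_sum_delta v) linear_sum.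
by apply: eq_bigr => i _; rewrite linearZ/= -deriveE// mxE mulrC.
Qed.

(** The difference quotients of [dot (F _) v] are the images of those of [F]
    under the continuous linear form [dot _ v]. *)
Lemma is_derive_dotl (F : R -> 'rV[R]_d) (t : R) dF v :
  is_derive t 1 F dF -> is_derive t 1 (fun s => dot (F s) v) (dot dF v).
Proof.
move=> [cF <-]; have quotients :
    (fun h : R => h^-1 *: (((fun s => dot (F s) v) \o shift t) (h *: 1)
                     - dot (F t) v)) =
    (fun h => dot (h^-1 *: ((F \o shift t) (h *: 1) - F t)) v).
  by apply/funext => h; rewrite dotZl dotDl dotNl.
have cvg_dot :
    (fun h : R => dot (h^-1 *: ((F \o shift t) (h *: 1) - F t)) v) @ 0^' -->
    dot ('D_1 F t) v.
  apply: (@continuous_cvg _ _ _ _ _ _ (fun u => dot u v)) cF.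
  exact: continuous_dotl.
split; last by rewrite /derive quotients; exact: cvg_lim.
by rewrite /derivable quotients; apply/cvg_ex; eexists; exact: cvg_dot.
Qed.

End Lines.

(** * Global minimizers of a function with compact sublevel sets *)

Section SecondOrder.
Variables (R : realType) (d : nat) (f : 'rV[R]_d -> R).

(** By the triangle inequality, moving from [z] in any direction decreases
    [phi \o (f - m)] at a rate of at most [a].  In the direction of steepest
    descent this rate is the slope of [phi \o (f - m)]. *)
Lemma penalized_min_slope_le (phi : R -> R) (m a : R) (x z : 'rV[R]_d) :
  differentiable f z -> derivable phi (f z - m) 1 -> 0 <= a ->
  (forall y, phi (f z - m) + a * enorm (z - x) <=
             phi (f y - m) + a * enorm (y - x)) ->
  derive1 phi (f z - m) * enorm (grad f z) <= a.
Proof.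
move=> df dphi a0 zmin; set g := grad f z.
have z0 : z + 0 *: (- g) = z by rewrite scale0r addr0.
pose s t := f (z + t *: (- g)) - m.
have ds : is_derive (0 : R) 1 s (- enorm g ^+ 2).
  have := @is_derive_line _ _ _ f z (- g) 0.
  rewrite z0 => /(_ df).
  rewrite derive_grad// dotC dotNl -sqr_enorm => df0.
  rewrite -[X in is_derive _ _ _ X]subr0.
  by apply: is_deriveB.
have dphis : is_derive (0 : R) 1 (phi \o s)
    (derive1 phi (f z - m) * (- enorm g ^+ 2)).
  apply: is_derive1_comp.
  by rewrite /s z0 derive1E; exact: derivableP.
have := slope_ge (b := a * enorm g) dphis.
have steep : forall t, 0 < t -> (phi \o s) 0 <= (phi \o s) t + a * enorm g * t.
  move=> t t0; rewrite /= /s z0.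
  have := dist_triangle (z + t *: (- g)) z x.
  rewrite [_ - z]addrC addKr enormZ enormN gtr0_norm// => tri.
  by have := zmin (z + t *: (- g)); nra.
move=> /(_ steep).
have := enorm_ge0 g; rewrite le_eqVlt => /predU1P[<-|g0].
  by move=> _; rewrite mulr0.
by move=> slope; rewrite -(ler_pM2r g0); nra.
Qed.

(** The gradient vanishes by the slope bound with the zero penalty; the Hessian
    is semidefinite because its quadratic form is the second derivative of [f]
    along a line through its minimizer. *)
Lemma global_min_second_order_stationary (z : 'rV[R]_d) :
  continuously_twice_differentiable f -> (forall y, f z <= f y) ->
  second_order_stationary f z.
Proof.
move=> [df dgrad _] zmin.
have grad0 : grad f z = 0.
  have := @penalized_min_slope_le id 0 0 z z (df z)
    (@derivable_id _ _ _ _) (lexx 0).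
  rewrite derive1E derive_id mul1r => le0; apply/enorm_eq0/le_anti.
  by rewrite enorm_ge0 le0// => y; rewrite !mul0r !addr0 !subr0.
split=> // v; rewrite dot_mulmx /hessian -deriveEjacobian//.
have line0 : z + 0 *: v = z by rewrite scale0r addr0.
apply: (@second_derivative_min_ge0 _ (fun t => f (z + t *: v))
  (fun t => dot (grad f (z + t *: v)) v)).
- by move=> t; rewrite -derive_grad//; exact: is_derive_line.
- by rewrite line0 grad0 -(scale0r 0) dotZl mul0r.
- apply: is_derive_dotl; rewrite -[X in 'D_v _ X]line0.
  by apply: is_derive_line; rewrite line0.
- by move=> t; rewrite line0.
Qed.

End SecondOrder.

Section Coercive.
Variables (R : realType) (d : nat) (f : 'rV[R]_d -> R).
Hypothesis cf : continuous f.
Hypothesis compact_sublevel : forall alpha : R, compact [set x | f x <= alpha].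

(** With [h = f] this is a global minimizer of [f]; in general it is a
    global minimizer of [h] as soon as [h x <= h y] outside the sublevel
    set of [x]. *)
Lemma sublevel_min_exists (h : 'rV[R]_d -> R) x : continuous h ->
  exists2 z, f z <= f x & forall y, f y <= f x -> h z <= h y.
Proof.
move=> ch; have /EVT_min_rV : [set y | f y <= f x] !=set0 by exists x => /=.
move=> /(_ h (@compact_sublevel (f x))) [].
  exact: continuous_subspaceT.
by move=> z; rewrite inE => zx hz; exists z => // y yx; apply: hz; rewrite inE.
Qed.

(** On the compact set where [f <= m + 1] and the gradient has norm at least
    [e], the minimum of [f] exceeds [m], because points with [f <= m] are
    critical. *)
Lemma gradient_small_near_min (m e : R) :
  continuous (grad f) -> 0 < e -> (forall y, f y <= m -> grad f y = 0) ->
  exists2 lam, 0 < lam & forall y, f y < m + lam -> enorm (grad f y) < e.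
Proof.
move=> cgrad e0 crit.
pose A := [set y | f y <= m + 1] `&` [set y | e <= enorm (grad f y)].
have cA : compact A.
  apply: compact_closedI; first exact: compact_sublevel.
  apply: (@preimage_closed _ _ (fun y => enorm (grad f y)) [set t | e <= t]).
    move=> y _; apply: continuous_comp; first exact: cgrad.
    exact: continuous_enorm.
  exact: closed_ge.
have [A0|A0] := pselect (A !=set0); last first.
  exists 1 => // y ylt; rewrite ltNge; apply/negP => ey.
  by apply: A0; exists y; split => //=; exact: ltW.
have [z] := EVT_min_rV A0 cA (continuous_subspaceT cf).
rewrite inE => -[_ /= ez] zmin.
have mz : m < f z.
  rewrite ltNge; apply/negP => /crit gz; move: ez.
  by rewrite gz enorm0 leNgt e0.
exists (Num.min 1 (f z - m)); first by rewrite lt_min ltr01 subr_gt0.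
move=> y ylt; rewrite ltNge; apply/negP => ey.
have := ge_min (f z - m) 1 (f z - m); have := ge_min 1 1 (f z - m).
rewrite !lexx orbT /= => min1 minz.
have : f z <= f y by apply: zmin; rewrite inE; split => //=; lra.
by lra.
Qed.

End Coercive.

(** Constancy of [f] on its second-order stationary points excludes every such
    point that is not a global minimizer. *)
Lemma second_order_stationary_argmin (R : realType) (d : nat)
    (f : 'rV[R]_d -> R) (m : R) :
  continuously_twice_differentiable f ->
  (forall alpha : R, compact [set x | f x <= alpha]) ->
  takes_constant_value f (second_order_stationary f) m ->
  (forall x, m <= f x) /\ second_order_stationary f = [set x | f x <= m].
Proof.
move=> f2 csub fm; have [df _ _] := f2.
have cf : continuous f by move=> y; exact: differentiable_continuous.
have [z z0 sublevel_min] := sublevel_min_exists csub 0 cf.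
have zmin y : f z <= f y.
  have [|/ltW y0] := leP (f y) (f 0); first exact: sublevel_min.
  exact: le_trans z0 y0.
have zm : f z = m by apply/fm/global_min_second_order_stationary.
split=> [x|]; first by rewrite -zm.
apply/seteqP; split=> x /=; first by move/fm->.
rewrite -zm => xz; apply: global_min_second_order_stationary => // y.
exact: le_trans (zmin y).
Qed.

(** * The desingularizing function *)

Section Desingularizing.
Variables (R : realType) (c theta : R).
Hypotheses (c0 : 0 < c) (theta0 : 0 < theta).

Lemma is_derive_desingularizing (t : R) : 0 < t ->
  is_derive t 1 (desingularizing c theta) (c * t `^ (theta - 1)).
Proof.
move=> t0; have -> : c * t `^ (theta - 1) =
    c / theta *: (theta * t `^ (theta - 1)).
  by rewrite /GRing.scale/= mulrA divfK ?gt_eqF.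
by apply: is_deriveZ; exact: is_derive1_powR.
Qed.

Lemma desingularizing0 : desingularizing c theta 0 = 0.
Proof. by rewrite /desingularizing powR0 ?mulr0// gt_eqF. Qed.

Lemma desingularizing_ge0 t : 0 <= desingularizing c theta t.
Proof. by rewrite mulr_ge0 ?powR_ge0// divr_ge0// ltW. Qed.

Lemma desingularizing_le s t : 0 <= s -> s <= t ->
  desingularizing c theta s <= desingularizing c theta t.
Proof.
move=> s0 st; apply: ler_wpM2l; first by rewrite divr_ge0// ltW.
apply: (ge0_ler_powR (ltW theta0)) => //; rewrite nnegrE//.
exact: le_trans st.
Qed.

Lemma desingularizing_small e : 0 < e ->
  exists2 delta, 0 < delta &
    forall t, 0 <= t < delta -> desingularizing c theta t < e.
Proof.
move=> e0; have ce0 : 0 < e / (c / theta) by rewrite !divr_gt0.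
exists ((e / (c / theta)) `^ theta^-1); first exact: powR_gt0.
move=> t /andP[t0 td]; rewrite /desingularizing mulrC -ltr_pdivlMr ?divr_gt0//.
have := gt0_ltr_powR theta0 t0 (powR_ge0 _ _) td.
by rewrite -powRrM mulVf ?gt_eqF// powRr1// ltW.
Qed.

(** The norm is there because [t `^ theta] is 1 for negative [t], so that
    [desingularizing c theta] is discontinuous at 0. *)
Lemma continuous_desingularizing_norm :
  continuous (fun t : R => desingularizing c theta `|t|).
Proof.
move=> t; have [->|t0] := eqVneq t 0.
  rewrite /continuous_at normr0 desingularizing0.
  apply/cvgrPdist_lt => e /desingularizing_small[delta delta0 small].
  near=> s; rewrite sub0r normrN ger0_norm ?desingularizing_ge0//.
  apply: small; rewrite normr_ge0/=.
  near: s; apply/nbhs_normP; exists delta => // s.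
  by rewrite /ball_/= sub0r normrN.
apply: continuous_comp; first exact: norm_continuous.
apply/differentiable_continuous/derivable1_diffP.
have := @is_derive_desingularizing `|t|; rewrite normr_gt0 => /(_ t0).
by case.
Unshelve. all: by end_near. Qed.

(** The KL inequality at a point with gap [t] and gradient norm [g] is
    [t `^ (1 - theta) <= c * g]; both sides are raised to the power that turns
    the left one into [t `^ theta]. *)
Lemma gap_powR_le t g : 0 < t -> 0 <= g -> theta < 1 ->
  1 <= c * t `^ (theta - 1) * g ->
  t `^ theta <= (c * g) `^ (theta / (1 - theta)).
Proof.
move=> t0 g0 theta1 KLt; have th1 : 0 < 1 - theta by rewrite subr_gt0.
have t_gt0 : 0 < t `^ (1 - theta) by exact: powR_gt0.
have gap_le : t `^ (1 - theta) <= c * g.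
  move: KLt; rewrite -opprB powRN mulrAC => KLt.
  by rewrite ler_pdivlMr// mul1r in KLt.
have -> : t `^ theta = (t `^ (1 - theta)) `^ (theta / (1 - theta)).
  by rewrite -powRrM mulrC divfK ?gt_eqF.
apply: ge0_ler_powR => //; rewrite ?nnegrE ?powR_ge0//.
- by rewrite divr_ge0// ltW.
- by rewrite mulr_ge0// ltW.
Qed.

End Desingularizing.

(** * The error bound *)

Section ErrorBound.
Variables (R : realType) (d : nat) (f : 'rV[R]_d -> R) (m : R).
Hypothesis df : forall x, differentiable f x.
Hypothesis compact_sublevel : forall alpha : R, compact [set x | f x <= alpha].
Hypothesis m_le : forall x, m <= f x.

Let S := [set x | f x <= m].

Variables (c theta epsilon lambda : R).
Hypotheses (c0 : 0 < c) (theta0 : 0 < theta).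
Let phi := desingularizing c theta.

Hypothesis KL : forall x, level_neighborhood f S m epsilon lambda x ->
  1 <= derive1 phi (f x - m) * enorm (grad f x).

(** The radius is halved and the value of [phi] bounded so that the minimizer
    [z] of the penalized function still lies in the region where the KL
    inequality holds. *)
Lemma dist_argmin_le (x : 'rV[R]_d) :
  level_neighborhood f S m (epsilon / 2) lambda x ->
  2 * phi (f x - m) <= epsilon / 2 ->
  (dist_set S x <= (2 * phi (f x - m))%:E)%E.
Proof.
move=> [dist_x /andP[mx xlam]] phi_small.
have cf : continuous f by move=> y; exact: differentiable_continuous.
pose h y := phi (f y - m) + 2^-1 * enorm (y - x).
have cphi : continuous (fun y => phi (f y - m)).
  rewrite (_ : (fun y => _) = (fun t => phi `|t|) \o (fun y => f y - m));
    last first.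
    by apply/funext => w /=; rewrite ger0_norm// subr_ge0.
  move=> y; apply: continuous_comp; last exact: continuous_desingularizing_norm.
  by apply: continuousB; [exact: cf|exact: cst_continuous].
have cdist : continuous (fun y : 'rV[R]_d => enorm (y - x)).
  move=> y; apply: continuous_comp; last exact: continuous_enorm.
  by apply: continuousB; [exact: cvg_id|exact: cst_continuous].
have ch : continuous h.
  rewrite /h => y.
  apply: (@continuousD R R 'rV[R]_d (fun y => phi (f y - m))); first exact: cphi.
  by apply: continuousM; [exact: cst_continuous|exact: cdist].
(* Outside the sublevel set of x both terms of h are at least their values at
   x, so a minimizer over that compact set is global. *)
have [z zx sublevel_min] := sublevel_min_exists compact_sublevel x ch.
have zmin y : h z <= h y.
  have [|/ltW xy] := leP (f y) (f x); first exact: sublevel_min.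
  apply: (le_trans (sublevel_min x (lexx _))).
  rewrite /h subrr enorm0 mulr0 addr0.
  rewrite (le_trans (desingularizing_le c0 theta0 _ (lerB xy (lexx m))))//.
    by rewrite subr_ge0.
  by rewrite lerDl mulr_ge0// enorm_ge0.
have zx_le : enorm (x - z) <= 2 * phi (f x - m).
  have := zmin x; rewrite /h subrr enorm0 mulr0 addr0 -(opprB x z) enormN.
  have : 0 <= phi (f z - m) by exact: desingularizing_ge0.
  by lra.
have Sz : S z.
  rewrite /S/= leNgt; apply/negP => mz.
  have dphi : derivable phi (f z - m) 1.
    have := @is_derive_desingularizing _ c _ theta0 (f z - m).
    by rewrite subr_gt0 => /(_ mz)[].
  have := penalized_min_slope_le (df z) dphi (a := 2^-1) _ zmin.
  have KLz : 1 <= derive1 phi (f z - m) * enorm (grad f z).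
    apply: KL; split; last by rewrite mz (le_lt_trans zx).
    move: dist_x => /ereal_inf_ltP[_ [w Sw <-]]; rewrite lte_fin => xw.
    apply/ereal_inf_ltP; exists (enorm (z - w))%:E; first by exists w.
    rewrite lte_fin (le_lt_trans (dist_triangle z x w))//.
    by rewrite -(opprB x z) enormN; lra.
  by rewrite invr_ge0 ler0n => /(_ isT); lra.
by apply: ge_ereal_inf; exists (enorm (x - z))%:E; [exists z|rewrite lee_fin].
Qed.

End ErrorBound.

Theorem proposition1 (R : realType) (d : nat) (f : 'rV[R]_d -> R)
    (L : R) (C : set 'rV[R]_d) (theta fOmega : R) :
  assumptionA f L C ->
  KL_property f theta ->
  takes_constant_value f (second_order_stationary f) fOmega ->
  exists kappa epsilon lambda : R,
    [/\ 0 < kappa, 0 < epsilon, 0 < lambda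
      & forall x,
          level_neighborhood f (second_order_stationary f) fOmega
            epsilon lambda x ->
          (dist_set (second_order_stationary f) x <=
             kappa%:E * epowR (enorm (grad f x))
                              (theta%:E / (1 - theta)%:E))%E].
Proof.
move=> [f2 _ csub _ _] [/andP[theta0 theta1] KLf] fconst.
have [df dgrad _] := f2.
have cf : continuous f by move=> y; exact: differentiable_continuous.
have cgrad : continuous (grad f) by move=> y; exact: differentiable_continuous.
have [m_le argmin] := second_order_stationary_argmin f2 csub fconst.
set m := fOmega in fconst m_le argmin *; rewrite argmin.
have constS : takes_constant_value f [set x | f x <= m] m.
  by move=> y /= ym; apply/le_anti; rewrite ym m_le.
have [eps [lam [c [eps0 lam0 c0 KL]]]] := KLf _ _ (csub m) constS.
have {}KL x : level_neighborhood f [set x | f x <= m] m eps lam x ->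
    1 <= derive1 (desingularizing c theta) (f x - m) * enorm (grad f x).
  move=> zone; have [/ereal_inf_ltP[_ [w Sw _] _] _] := zone.
  exact: KL Sw zone.
have KLpow x : level_neighborhood f [set x | f x <= m] m eps lam x ->
    1 <= c * (f x - m) `^ (theta - 1) * enorm (grad f x).
  move=> zone; have [_ /andP[mx _]] := zone.
  have := @is_derive_desingularizing _ c _ theta0 (f x - m).
  rewrite subr_gt0 => /(_ mx)[_ <-]; rewrite -derive1E; exact: KL.
have [theta_lt1|theta_ge1] := ltrP theta 1; last first.
  (* The KL inequality forces a gradient of norm at least c^-1, so lam1 makes
     the neighbourhood empty, and any kappa will do. *)
  have {theta1 theta_ge1} th1 : theta = 1 by apply/le_anti; rewrite theta1.
  have crit y : f y <= m -> grad f y = 0.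
    move=> ym; have : second_order_stationary f y by rewrite argmin.
    by case.
  have cV0 : 0 < c^-1 by rewrite invr_gt0.
  have [lam1 lam10 small] := gradient_small_near_min cf csub cgrad cV0 crit.
  exists 1, eps, (Num.min lam lam1); split => //; first by rewrite lt_min lam0.
  move=> x [dist_x /andP[mx]]; rewrite -ltrBlDl lt_min => /andP[xlam xlam1].
  have /KLpow : level_neighborhood f [set x | f x <= m] m eps lam x.
    by split => //; rewrite mx -ltrBlDl.
  rewrite th1 subrr powRr0 mulr1 -ler_pdivrMl// mulr1 leNgt small//.
  by rewrite -ltrBlDl.
set r := theta / (1 - theta).
have th1 : 0 < 1 - theta by rewrite subr_gt0.
(* With phi below eps / 4 the bound 2 * phi stays below eps / 2. *)
have e40 : 0 < eps / 4 by rewrite divr_gt0.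
have [lam1 lam10 small] := desingularizing_small c0 theta0 e40.
exists (2 * (c / theta * c `^ r)), (eps / 2), (Num.min lam lam1); split.
- by rewrite !mulr_gt0 ?invr_gt0 ?powR_gt0.
- by rewrite divr_gt0.
- by rewrite lt_min lam0.
move=> x [dist_x /andP[mx]]; rewrite -ltrBlDl lt_min => /andP[xlam xlam1].
have t0 : 0 < f x - m by rewrite subr_gt0.
have zone2 : level_neighborhood f [set x | f x <= m] m (eps / 2) lam x.
  by split => //; rewrite mx -ltrBlDl.
have zone : level_neighborhood f [set x | f x <= m] m eps lam x.
  split; last by have [] := zone2.
  by apply: (lt_trans dist_x); rewrite lte_fin ltr_pdivrMr// ltr_pMr// ltr1n.
have phi_small : 2 * desingularizing c theta (f x - m) <= eps / 2.
  have := small (f x - m); rewrite xlam1 (ltW t0) => /(_ isT); lra.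
apply: (le_trans (dist_argmin_le df csub m_le c0 theta0 KL zone2 phi_small)).
rewrite inver gt_eqF// -EFinM -/r lee_fin /desingularizing -!mulrA ler_pM2l//.
rewrite ler_pM2l// ler_pM2l ?invr_gt0// -powRM ?(ltW c0) ?enorm_ge0//.
by apply: (gap_powR_le c0) => //; [exact: enorm_ge0|exact: KLpow].
Qed.
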